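(* Let $G$ be a finite group and $V\subset\mathbb{C}[G]$ a subrepresentation, with decomposition $V=\bigoplus_{\chi\in\mathrm{Irr}(G)}V_\chi$, $V_\chi=W_\chi\otimes U_\chi$, $U_\chi\subset W_\chi^\vee$. Then $V$ yields a map of $G$ into $\mathbb{P}(V^\vee)$ (i.e. the evaluation functional of every $g\in G$ is nonzero on $V$) if and only if $V\neq 0$. This map embeds $G$ (i.e. is injective) only if the following two properties hold: (i) $\bigcap_{\chi:\,U_\chi\neq 0}\ker(\rho_\chi)=\{1\}$; (ii) let $\chi_1,\dots,\chi_m$ be the irreducible characters with $U_{\chi_j}\neq 0$, and let $\psi_j$ be the character of the centre $Z(G)$ through which $\rho_{\chi_j}$ maps $Z(G)$ to scalar multiples of the identity; then $\psi_1,\dots,\psi_m$ are affine generators of the character group $Z(G)^*=\mathrm{Hom}(Z(G),\mathbb{C}^* )$, i.e. the characters $\psi_j/\psi_1$ generate $Z(G)^*$. If moreover $V$ is full, the two conditions (i) and (ii) are also sufficient. If $V$ is not full, we obtain a projective embedding of $G$ if $V$ is projectively general (i.e. if each space $U_\chi\neq 0$ is projectively general). (iii) In general, $V\subset\mathbb{C}[G]$ provides a projective embedding of $G$ if and only if the set $$G_{\mathbb{P}(V)}:=\Big\{g\in G\ :\ \mathbb{P}\big(\textstyle\bigoplus_{U_\chi\neq0}\epsilon^*_\chi\big)(g)=\mathrm{Id}\ \text{ on }\ \mathbb{P}\big(\bigoplus_{U_\chi\neq0}U_\chi\big)\Big\}$$ (that is, the set of those $g$ for which there is $\lambda\in\mathbb{C}^*$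 with $\epsilon^*_\chi(g)(u)=\lambda u$ for all $\chi$ and all $u\in U_\chi$) consists only of the neutral element $1\in G$.
   Context: $\mathbb{C}[G]$ is viewed as the space of complex-valued functions on $G$, with $g\in G$ identified with its characteristic function, and as a left $\mathbb{C}[G]$-module by left multiplication, i.e. $(\gamma f)(x)=f(\gamma^{-1}x)$; a subrepresentation is a left submodule. For an irreducible character $\chi$, $\rho_\chi:G\to GL(W_\chi)$ is the corresponding representation and $e(\chi)=\frac{\chi(1)}{|G|}\sum_{g}\chi(g^{-1})g$. The isotypic component $\mathcal{A}_\chi=\mathbb{C}[G]e(\chi)$ is identified with $W_\chi\otimes W_\chi^\vee$, where $w\otimes u$ corresponds to the function $g\mapsto u(\rho_\chi(g^{-1})w)$. Every subrepresentation $V$ is $\bigoplus_\chi V_\chi$ with $V_\chi=V\cap\mathcal{A}_\chi=W_\chi\otimes U_\chi$ for a unique subspace $U_\chi\subset W_\chi^\vee$. $\epsilon^*:G\to V^\vee$ sends $g$ to evaluation at $g$, and its component in $V_\chi^\vee=\mathrm{Hom}(U_\chi,W_\chi^\vee)$ is $\epsilon^*_\chi(g):u\mapsto u\circ\rho_\chi(g^{-1})$. The map $G\to\mathbb{P}(V^\vee)$ is the projectivization of $\epsilon^*$; $V$ provides a projective embedding of $G$ if this map is injective. $V$ is full if it is a direct sum of some of the $\mathcal{A}_\chi$ (each nonzero $U_\chi$ equals $W_\chi^\vee$). $U_\chi$ is projectively general if it is not contained in a proper eigenspace for the action of any element $g\in G$ on $W_\chi^\vee$; $V$ is projectively general if every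 nonzero $U_\chi$ is.
   Formalization: For V not full and projectively general, (i) and (ii) are kept as hypotheses: without them the claim fails (S3×Z/2, V=W⊗U with W the 2-dimensional irrep of S3, U a generic line). After the first equivalence V≠0 is assumed, since (iii) fails for G=1, V=0. *)

(* Defs.v *)
From HB Require Import structures.
From mathcomp Require Import all_boot all_order all_fingroup all_algebra.
From mathcomp Require Import center mxrepresentation.
From mathcomp Require Import reals complex.

Set Implicit Arguments.
Unset Strict Implicit.
Unset Printing Implicit Defensive.

Import Order.TTheory GRing.Theory Num.Theory.
Local Open Scope ring_scope.

Section ProjectiveEmbeddings.

Variables (C : numClosedFieldType) (gT : finGroupType).

Local Notation G := [set: gT]%G.

(** C[G] as functions on G; g in G is the indicator function of {g}. *)
Definition group_alg := {ffun gT -> C^o}.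

(** [(g f)(x) = f (g^-1 x)] *)
Definition ltrans (g : gT) (f : group_alg) : group_alg :=
  [ffun x => f (g^-1 * x)%g].

Definition subrepresentation (V : {vspace group_alg}) : Prop :=
  forall (g : gT) (f : group_alg), f \in V -> ltrans g f \in V.

(** The product of C[G], in terms of functions. *)
Definition conv (f h : group_alg) : group_alg :=
  [ffun x => \sum_(y : gT) f y * h (y^-1 * x)%g].

Definition convr (h f : group_alg) : group_alg := conv f h.

Fact convr_is_linear h : linear (convr h).
Proof.
move=> a f1 f2; apply/ffunP => x; rewrite !ffunE scaler_sumr -big_split /=.
by apply: eq_bigr => y _; rewrite !ffunE mulrDl -scalerAl.
Qed.

HB.instance Definition _ h :=
  GRing.isLinear.Build C group_alg group_alg _ (convr h) (convr_is_linear h).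

(** The map to P(V^v): evaluation functionals, and the points of P(V^v) as the
    lines spanned by nonzero functionals. *)

Definition eval_at (V : {vspace group_alg}) (g : gT) : 'Hom(subvs_of V, C^o) :=
  linfun (fun f : subvs_of V => (vsval f : group_alg) g).

Definition yields_map (V : {vspace group_alg}) : Prop :=
  forall g : gT, eval_at V g != 0.

Definition proj_map (V : {vspace group_alg}) (g : gT) :
  {vspace 'Hom(subvs_of V, C^o)} := <[eval_at V g]>%VS.

Definition projective_embedding (V : {vspace group_alg}) : Prop :=
  yields_map V /\ injective (proj_map V).

Fact eval_is_linear (V : {vspace group_alg}) (g : gT) :
  linear (fun f : subvs_of V => (vsval f : group_alg) g : C^o).
Proof. by move=> a f1 f2; rewrite linearP /= !ffunE. Qed.

Lemma eval_atE (V : {vspace group_alg}) (g : gT) (f : subvs_of V) :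
  eval_at V g f = (vsval f : group_alg) g.
Proof.
pose L := GRing.isLinear.Build C (subvs_of V) C^o _ _ (@eval_is_linear V g).
pose ev : {linear subvs_of V -> C^o} := HB.pack (fun f : subvs_of V =>
  (vsval f : group_alg) g : C^o) L.
exact: (lfunE ev f).
Qed.

(** Irreducible representations are indexed by [sG].  The space [W_i] is the
    space of column vectors, on which g acts on the left by [irr_repr i g]; its
    dual is the space of row vectors, [u] being the functional [w |-> u *m w]. *)

Variable sG : irrType C G.
Implicit Type i : sG.

Definition dual_space i := 'rV[C]_(irr_degree i).

(** The function [x |-> u (rho_i (x^-1) w)]. *)
Definition pure_tensor i (w : 'cV[C]_(irr_degree i)) (u : dual_space i) :
    group_alg :=
  [ffun x => (u *m (irr_repr i x^-1%g *m w)) 0 0].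

(** The subspace [W_i (x) U] of C[G]. *)
Definition tensor_space i (U : {vspace dual_space i}) : {vspace group_alg} :=
  <<[seq pure_tensor w u | w <- vbasis {:'cV[C]_(irr_degree i)},
                           u <- vbasis U]>>%VS.

Definition irr_char i (g : gT) : C := \tr (irr_repr i g).

(** [e(chi) = chi(1)/|G| sum_g chi(g^-1) g] *)
Definition central_idem i : group_alg :=
  [ffun g => irr_char i 1%g / #|G|%:R * irr_char i g^-1%g].

(** [C[G] e(chi)] *)
Definition isotypic i : {vspace group_alg} :=
  limg (linfun (convr (central_idem i))).

Definition multiplicity_spaces (V : {vspace group_alg})
    (U : forall i, {vspace dual_space i}) : Prop :=
  forall i, (V :&: isotypic i)%VS = tensor_space (U i).

Definition full (V : {vspace group_alg}) : Prop :=
  exists S : {set sG}, V = (\sum_(i in S) isotypic i)%VS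
    /\ directv (\sum_(i in S) isotypic i).

(** The action [u |-> u o rho_i (g^-1)] of g on the dual of [W_i]; its
    restriction to [U_i] is [epsilon*_i (g)]. *)
Definition dual_act i (g : gT) : 'End(dual_space i) :=
  linfun (mulmxr (irr_repr i g^-1%g)).

Lemma dual_actE i g (u : dual_space i) :
  dual_act i g u = u *m irr_repr i g^-1%g.
Proof. exact: (lfunE (mulmxr (irr_repr i g^-1%g)) u). Qed.

Definition projectively_general_at i (U : {vspace dual_space i}) : Prop :=
  forall (g : gT) (a : C),
    passmx.leigenspace (dual_act i g) a != fullv ->
    ~~ (U <= passmx.leigenspace (dual_act i g) a)%VS.

Section MultiplicitySpaces.

Variable U : forall i, {vspace dual_space i}.

Definition projectively_general : Prop :=
  forall i, U i != 0%VS -> projectively_general_at (U i).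

Definition jointly_faithful : Prop :=
  (\bigcap_(i | U i != 0%VS) rker (irr_repr i))%g = 1%g :> {set gT}.

(** Homomorphisms from Z(G) to the nonzero elements of C; only the values of
    [xi] on Z(G) matter. *)
Definition center_character (xi : gT -> C) : Prop :=
  {in 'Z(G)%g, forall z, xi z != 0} /\
  {in 'Z(G)%g &, {morph xi : x y / (x * y)%g >-> x * y}}.

(** On Z(G), [irr_mode i] is the character through which [irr_repr i] acts by
    scalars.  The group generated by the quotients by [psi_1] does not depend
    on which of the occurring characters is taken as [psi_1]. *)
Definition affine_generators : Prop :=
  exists2 i1, U i1 != 0%VS &
    forall xi, center_character xi ->
      exists k : sG -> int,
        {in 'Z(G)%g, forall z,
          xi z = \prod_(i | U i != 0%VS) (irr_mode i z / irr_mode i1 z) ^ k i}.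

(** Membership in [G_{P(V)}]. *)
Definition acts_projectively_trivially (g : gT) : Prop :=
  exists2 lambda : C, lambda != 0 &
    forall i (u : dual_space i), U i != 0%VS -> u \in U i ->
      dual_act i g u = lambda *: u.

End MultiplicitySpaces.

End ProjectiveEmbeddings.

(* Main.v *)
(** Since [V] is stable under left translations, the points of [P(V^v)] given
    by [g] and [h] coincide iff [f (x k) = a f x] for some scalar [a] and all
    [f] in [V], where [k = h^-1 g].  The central idempotents split [V] into its
    intersections with the isotypic components, on which right translation by
    [k] is [1 (x) dual_act k]; this gives (iii).  If [k] acts on every [W_i]
    that occurs as the same scalar [a], then [k] is central by (i), all
    [psi_i / psi_1] are trivial on [k], so [psi_1 k = 1] by (ii), and [k = 1] by
    (i) again.  If [V] is full, then it is stable under right translations as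
    well, so an eigenspace containing [U_i] contains the orbit of a nonzero
    vector, hence the irreducible [W_i^v].  Conversely, under an embedding the
    [psi_i / psi_1] separate the points of [Z(G)], and a family of characters
    of a finite group that separates points generates all characters. *)
Require Import Defs.
From mathcomp Require Import all_boot all_order all_fingroup all_algebra.
From mathcomp Require Import center mxrepresentation.
From mathcomp Require Import reals complex.
From HB Require Import structures.
From mathcomp Require Import pgroup boolp ring.

Set Implicit Arguments.
Unset Strict Implicit.
Unset Printing Implicit Defensive.

Import GRing.Theory Num.Theory.
Local Open Scope ring_scope.

(** * Multiplicative functions on a finite group *)

Definition multiplicative_on (F : fieldType) (gT : finGroupType) (A : {set gT})
    (xi : gT -> F) : Prop :=
  {in A, forall z, xi z != 0} /\
  {in A &, {morph xi : x y / (x * y)%g >-> x * y}}.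

(** Translating the summation variable by [z0] multiplies the sum by [xi z0]. *)
Lemma sum_multiplicative_eq0 (F : fieldType) (gT : finGroupType)
    (Z : {group gT}) (xi : gT -> F) (z0 : gT) :
  multiplicative_on Z xi -> z0 \in Z -> xi z0 != 1 -> \sum_(z in Z) xi z = 0.
Proof.
move=> [_ xiM] Zz0 xi_z0; apply/eqP.
have : (\sum_(z in Z) xi z) * (xi z0 - 1) == 0.
  rewrite mulrBr mulr1 subr_eq0 eq_sym; apply/eqP.
  rewrite mulr_suml (reindex_inj (mulIg z0)) /=; apply: eq_big => z.
    by rewrite groupMr.
  by rewrite groupMr // => Zz; rewrite xiM.
by rewrite mulf_eq0 subr_eq0 (negPf xi_z0) orbF.
Qed.

Lemma multiplicative_on1 (F : fieldType) (gT : finGroupType)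
    (Z : {group gT}) (xi : gT -> F) :
  multiplicative_on Z xi -> xi 1%g = 1.
Proof.
move=> [xi0 xiM]; apply: (mulfI (xi0 _ (group1 Z))).
by rewrite mulr1 -xiM ?group1 // mulg1.
Qed.

(* Products of [chi i - c] span all functions on Z, so a character [xi]
   orthogonal to every monomial in the [chi i] would be orthogonal to the
   indicator function of 1. *)
Lemma separating_characters_generate (F : fieldType) (gT : finGroupType)
    (Z : {group gT}) (I : finType) (P : pred I) (chi : I -> gT -> F)
    (xi : gT -> F) :
  (forall i, P i -> multiplicative_on Z (chi i)) ->
  {in Z, forall z, (forall i, P i -> chi i z = 1) -> z = 1%g} ->
  multiplicative_on Z xi ->
  exists k : I -> int,
    {in Z, forall z, xi z = \prod_(i | P i) chi i z ^ k i}.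
Proof.
move=> chiP chi_sep xiP; apply: contrapT => no_k.
(* The factor for [(y, i)] vanishes at [z = y]. Pairs with [chi i y = 1] are skipped, so that the
   product stays nonzero at [z = 1]. *)
have orth (s : seq (gT * I)) (k : I -> int) :
  \sum_(z in Z) (xi z)^-1 * (\prod_(i | P i) chi i z ^ k i) *
    \prod_(p <- s | P p.2 && (chi p.2 p.1 != 1)) (chi p.2 z - chi p.2 p.1) = 0.
  elim: s k => [|[y j] s IHs] k.
    have [z0 Zz0 xi_z0]: exists2 z0, z0 \in Z &
        xi z0 != \prod_(i | P i) chi i z0 ^ k i.
      apply: contrapT => xi_k; case: no_k; exists k => z Zz.
      by apply/eqP; apply: contra_notT xi_k; exists z.
    under eq_bigr do rewrite big_nil mulr1.
    apply: (sum_multiplicative_eq0 (z0 := z0)) => //.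
      split=> [z Zz|z1 z2 Zz1 Zz2].
        rewrite mulf_neq0 ?invr_eq0 ?xiP.1 //; apply/prodf_neq0 => i Pi.
        by rewrite expfz_neq0 // (chiP i Pi).1.
      rewrite xiP.2 // invfM mulrACA -big_split /=; congr (_ * _).
      by apply: eq_bigr => i Pi; rewrite (chiP i Pi).2 // expfzMl.
    apply: contra_neq xi_z0 => /(canRL (mulVKf (xiP.1 _ Zz0))) ->.
    by rewrite mulr1.
  case Pjy: (P j && (chi j y != 1)); last first.
    by rewrite -[RHS](IHs k); apply: eq_bigr => z _; rewrite big_cons /= Pjy.
  have [Pj _] := andP Pjy.
  (* Raising the exponent of [chi j] by one absorbs [chi j z], so expanding the new factor gives a
     difference of two instances of the induction hypothesis. *)
  pose k' i := k i + (i == j)%:Z.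
  have := congr2 (fun a b => a - chi j y * b) (IHs k') (IHs k).
  rewrite mulr0 subr0 mulr_sumr -sumrB => E; rewrite -[RHS]E.
  apply: eq_bigr => z Zz; rewrite big_cons /= Pjy.
  suff -> : \prod_(i | P i) chi i z ^ k' i =
      chi j z * \prod_(i | P i) chi i z ^ k i by ring.
  rewrite (bigD1 j) //= (bigD1 j (P := P)) //= mulrA; congr (_ * _).
    by rewrite /k' eqxx expfzDr ?(chiP _ Pj).1 // mulrC.
  by apply: eq_bigr => i /andP[_ /negPf i_j]; rewrite /k' i_j addr0.
(* With all pairs in the list, any [z] in [Z] other than 1 meets a vanishing factor [(z, i)] by
   separation; only the nonzero term at 1 survives. *)
have := orth (enum {: gT * I}) (fun=> 0); rewrite (bigD1 1%g) ?group1 //=.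
rewrite [X in _ + X]big1 ?addr0 => [/eqP|z /andP[Zz z1]]; last first.
  apply/eqP; rewrite mulf_eq0; apply/orP; right.
  have [i Pi chi_iz]: exists2 i, P i & chi i z != 1.
    apply: contrapT => chi_z; case/eqP: z1; apply: chi_sep => // i Pi.
    by apply/eqP; apply: contra_notT chi_z; exists i.
  rewrite big_enum_cond (bigD1 (z, i)) /= ?Pi //.
  by rewrite subrr mul0r.
apply/negP; rewrite !mulf_neq0 ?invr_eq0 ?xiP.1 //.
  by rewrite big1 ?oner_neq0 // => i _; rewrite expr0z.
rewrite big_enum_cond; apply/prodf_neq0 => -[y i] /= /andP[Pi chi_iy].
by rewrite subr_eq0 eq_sym (multiplicative_on1 (chiP i Pi)).
Qed.

Lemma leigenspaceP (F : fieldType) (W : vectType F) (phi : 'End(W)) (a : F)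
    (v : W) :
  reflect (phi v = a *: v) (v \in passmx.leigenspace phi a).
Proof.
rewrite memv_ker add_lfunE opp_lfunE scale_lfunE id_lfunE subr_eq0.
exact: eqP.
Qed.

(** * Right translation and coincidence of points in the projective space *)

Section RightTranslation.

Variables (C : numClosedFieldType) (gT : finGroupType).
Implicit Types (f : group_alg C gT) (V : {vspace group_alg C gT}) (k : gT).

Definition rtrans k f : group_alg C gT := [ffun x => f (x * k)%g].

Fact rtrans_is_linear k : linear (rtrans k).
Proof. by move=> a f1 f2; apply/ffunP => x; rewrite !ffunE. Qed.

HB.instance Definition _ k :=
  GRing.isLinear.Build C (group_alg C gT) (group_alg C gT) _ (rtrans k)
    (rtrans_is_linear k).

Definition right_eigenspace k (a : C) : {vspace group_alg C gT} :=
  passmx.leigenspace (linfun (rtrans k)) a.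

Lemma right_eigenspaceP k (a : C) f :
  reflect (forall x, f (x * k)%g = a * f x) (f \in right_eigenspace k a).
Proof.
apply: (iffP (leigenspaceP _ _ _)); rewrite lfunE /= => Ef.
  by move=> x; have /ffunP/(_ x) := Ef; rewrite !ffunE.
by apply/ffunP => x; rewrite !ffunE.
Qed.

Lemma yields_mapP V :
  subrepresentation V -> yields_map V <-> V <> 0%VS.
Proof.
move=> Vsub; split=> [Vmap V0 | V0 g].
  have /eqP[] := Vmap 1%g; apply/lfunP => f; rewrite eval_atE lfunE /=.
  by have := subvsP f; rewrite {2}V0 memv0 => /eqP ->; rewrite ffunE.
apply: contra_notN V0 => /eqP ev0; apply/eqP; rewrite -subv0.
apply/subvP => f Vf.
rewrite memv0; apply/eqP/ffunP => x; rewrite ffunE.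
(* This left translate of [f] takes at [g] the value [f x]. *)
have /lfunP/(_ (vsproj V (ltrans (g * x^-1)%g f))) := ev0.
by rewrite eval_atE vsprojK ?Vsub // !lfunE ffunE invMg invgK mulgKV.
Qed.

Lemma projective_embeddingP V :
  subrepresentation V -> V <> 0%VS ->
  projective_embedding V <->
  (forall k a, a != 0 -> (V <= right_eigenspace k a)%VS -> k = 1%g).
Proof.
move=> Vsub V0; have Vmap := (yields_mapP Vsub).2 V0.
split=> [[_ Vinj] k a a0 /subvP Vka | Vtriv].
  (* The points to compare are those of [k] and 1. *)
  apply: Vinj; rewrite /proj_map; apply/eqP.
  have -> : eval_at V k = a *: eval_at V 1%g.
    apply/lfunP => f; rewrite lfunE /= !eval_atE.
    by have /right_eigenspaceP/(_ 1%g) := Vka _ (subvsP f); rewrite mul1g.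
  rewrite eqEsubv -!memvE memvZ ?memv_line //=.
  by rewrite -{1}[eval_at V 1%g](scalerK a0) memvZ ?memv_line.
split=> // g h Egh.
have /vlineP[a Ea]: eval_at V g \in <[eval_at V h]>%VS.
  by rewrite -/(proj_map V h) -Egh memv_line.
have a0 : a != 0 by apply: contraNneq (Vmap g) => a0; rewrite Ea a0 scale0r.
suff /(Vtriv _ _ a0) : (V <= right_eigenspace (h^-1 * g)%g a)%VS.
  by move/(canRL (mulKVg h)); rewrite mulg1.
apply/subvP => f Vf; apply/right_eigenspaceP => x.
(* This translate takes the value [f x] at [h] and [f (x * (h^-1 * g))] at [g]. *)
have /lfunP/(_ (vsproj V (ltrans (h * x^-1)%g f))) := Ea.
rewrite scale_lfunE !eval_atE vsprojK ?Vsub // !ffunE invMg invgK.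
by rewrite mulgKV mulgA.
Qed.

End RightTranslation.

(** * Central idempotents and isotypic components *)

Section Decomposition.

Variables (C : numClosedFieldType) (gT : finGroupType).
Variable (sG : irrType C [set: gT]).
Implicit Types (i : sG) (f : group_alg C gT) (V : {vspace group_alg C gT}).
Implicit Types (g h k x y : gT) (a : C).

Local Notation G := [set: gT]%G.

Lemma irr_reprM i g h : irr_repr i (g * h)%g = irr_repr i g *m irr_repr i h.
Proof. by rewrite repr_mxM ?inE. Qed.

Lemma irr_charC i g h : irr_char i (g * h)%g = irr_char i (h * g)%g.
Proof. by rewrite /irr_char !irr_reprM mxtrace_mulC. Qed.

Lemma central_idemC i g h :
  central_idem i (g * h)%g = central_idem i (h * g)%g.
Proof. by rewrite !ffunE !invMg irr_charC. Qed.

(** Multiplication by [g] permutes the basis of the regular representation, without fixed points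
    unless [g] is 1. *)
Lemma mxtrace_regular_repr (F : fieldType) g :
  \tr (regular_repr F G g) = (if g == 1%g then #|G| else 0)%:R.
Proof.
rewrite /mxtrace; case: eqP => [-> | /eqP g1].
  rewrite (eq_bigr (fun=> 1)) ?sumr_const ?card_ord // => j _.
  by rewrite repr_mx1 mxE eqxx.
rewrite big1 // => j _; rewrite !mxE eqxx /=.
case: eqP => // /(congr1 enum_val); rewrite gring_indexK ?inE //.
by rewrite -{1}[enum_val j]mulg1 => /mulgI eg1; rewrite -eg1 eqxx in g1.
Qed.

(** The left side is the regular character at [g^-1], decomposed into irreducibles and divided by
    the order of the group. *)
Lemma sum_central_idem g : \sum_(i : sG) central_idem i g = (g == 1%g)%:R.
Proof.
have F'G : ([pchar C]^'.-group G)%g.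
  by apply/pgroupP => p _; rewrite inE /= pchar_num.
have cardG0 : #|G|%:R != 0 :> C by rewrite pnatr_eq0 -lt0n cardG_gt0.
transitivity (\tr (regular_repr C G g^-1%g) / #|G|%:R).
  rewrite (mxtrace_regular_pchar sG F'G) ?inE //; last first.
    exact: group_closure_closed_field.
  rewrite mulr_suml; apply: eq_bigr => i _.
  rewrite ffunE {1}/irr_char repr_mx1 mxtrace1 -[\tr _ *+ _]mulr_natl.
  exact: mulrAC.
by rewrite mxtrace_regular_repr invg_eq1; case: eqP; rewrite ?divff ?mul0r.
Qed.

(** As [central_idem i] is a class function, convolving with it on the right is a linear combination
    of left translations. *)
Lemma conv_central_idem_mem V i f :
  subrepresentation V -> f \in V -> conv f (central_idem i) \in V.
Proof.
move=> Vsub Vf.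
suff -> : conv f (central_idem i) =
    \sum_z (central_idem i z : C) *: ltrans z f.
  by apply: memv_suml => z _; rewrite memvZ ?Vsub.
apply/ffunP => x; rewrite ffunE sum_ffunE.
rewrite [RHS](reindex_inj invg_inj) [RHS](reindex_inj (mulIg x^-1%g)) /=.
apply: eq_bigr => z _; rewrite [in RHS]ffunE [ltrans _ _ _]ffunE.
by rewrite !invMg !invgK mulgKV central_idemC mulrC.
Qed.

Lemma conv_central_idem_isotypic i f : conv f (central_idem i) \in isotypic i.
Proof.
have -> : conv f (central_idem i) = linfun (convr (central_idem i)) f.
  by rewrite lfunE.
by rewrite memv_img ?memvf.
Qed.

Lemma sum_conv_central_idem f : \sum_(i : sG) conv f (central_idem i) = f.
Proof.
apply/ffunP => x; rewrite sum_ffunE.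
under eq_bigr do rewrite ffunE; rewrite exchange_big /=.
under eq_bigr do rewrite -mulr_sumr sum_central_idem -eq_invg_mul invgK.
rewrite (bigD1 x) //= eqxx mulr1 big1 ?addr0 // => y /negPf ->.
by rewrite mulr0.
Qed.

(** The pieces [conv f (central_idem i)] of [f] lie in [V] and in the isotypic components, and they
    add up to [f]. *)
Lemma subrep_subvP V (E : {vspace group_alg C gT}) :
  subrepresentation V ->
  (forall i, (V :&: isotypic i <= E)%VS) -> (V <= E)%VS.
Proof.
move=> Vsub VE; apply/subvP => f Vf; rewrite -(sum_conv_central_idem f).
apply: memv_suml => i _; apply: (subvP (VE i)).
by rewrite memv_cap conv_central_idem_mem ?conv_central_idem_isotypic.
Qed.

Lemma rtrans_conv h f i :
  rtrans h (conv f (central_idem i)) = conv (rtrans h f) (central_idem i).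
Proof.
apply/ffunP => x; rewrite !ffunE (reindex_inj (mulIg h)) /=.
apply: eq_bigr => y _; rewrite [rtrans h f y]ffunE invMg mulgA.
by rewrite central_idemC !mulgA mulgV mul1g.
Qed.

Lemma rtrans_isotypic h i f : f \in isotypic i -> rtrans h f \in isotypic i.
Proof.
case/memv_imgP => f' _ ->; rewrite lfunE /= /convr rtrans_conv.
exact: conv_central_idem_isotypic.
Qed.

Lemma rtrans_full V h f : full sG V -> f \in V -> rtrans h f \in V.
Proof.
case=> S [-> _] /memv_sumP[fs fsP ->]; rewrite linear_sum /=.
by apply: memv_sumr => i Si; rewrite rtrans_isotypic ?fsP.
Qed.

(** * Pure tensors and right eigenspaces *)

Lemma pure_tensor_sum i (I J : finType) (a : I -> C) (b : J -> C)
    (w : I -> 'cV_(irr_degree i)) (u : J -> dual_space i) :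
  pure_tensor (\sum_j a j *: w j) (\sum_l b l *: u l) =
  \sum_j \sum_l (a j * b l) *: pure_tensor (w j) (u l).
Proof.
apply/ffunP => x; rewrite ffunE sum_ffunE !mulmx_sumr summxE.
apply: eq_bigr => j _; rewrite sum_ffunE mulmx_suml summxE.
apply: eq_bigr => l _; rewrite !ffunE -!scalemxAr -scalemxAl !mxE.
by rewrite mulrA.
Qed.

Lemma pure_tensor_mem i (U : {vspace dual_space i}) w u :
  u \in U -> pure_tensor w u \in tensor_space U.
Proof.
move=> /coord_vbasis ->; rewrite (coord_vbasis (memvf w)) pure_tensor_sum.
apply: memv_suml => j _; apply: memv_suml => l _; apply/memvZ/memv_span.
apply/allpairsP; exists ((vbasis fullv)`_j, (vbasis U)`_l).
by rewrite !mem_nth ?size_tuple.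
Qed.

Lemma rtrans_pure_tensor i k (w : 'cV_(irr_degree i)) (u : dual_space i) :
  rtrans k (pure_tensor w u) = pure_tensor w (dual_act i k u).
Proof.
by apply/ffunP => x; rewrite !ffunE dual_actE invMg irr_reprM !mulmxA.
Qed.

Lemma pure_tensor_right_eigenspace i k a (u : dual_space i) :
  (forall w, pure_tensor w u \in right_eigenspace k a) <->
  u \in passmx.leigenspace (dual_act i k) a.
Proof.
split=> [Eu | /leigenspaceP Eu w].
  apply/leigenspaceP/rowP => j.
  (* With [w] the [j]-th basis vector, the value of the tensor at 1 is the [j]-th coordinate of
     [u]. *)
  have /leigenspaceP := Eu (delta_mx j 0).
  rewrite lfunE /= rtrans_pure_tensor => /ffunP/(_ 1%g).
  by rewrite !ffunE invg1 repr_mx1 mul1mx -!colE !mxE.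
apply/leigenspaceP; rewrite lfunE /= rtrans_pure_tensor Eu.
by apply/ffunP => x; rewrite !ffunE -scalemxAl mxE.
Qed.

Lemma tensor_space_right_eigenspace i k a (U : {vspace dual_space i}) :
  (tensor_space U <= right_eigenspace k a)%VS <->
  (U <= passmx.leigenspace (dual_act i k) a)%VS.
Proof.
split=> [/subvP TE | /subvP UE].
  apply/subvP => u Uu; apply/pure_tensor_right_eigenspace => w.
  exact/TE/pure_tensor_mem.
apply/span_subvP => _ /allpairsP[[w u] /= [_ Uu ->]].
by apply: (pure_tensor_right_eigenspace k a u).2; rewrite UE ?vbasis_mem.
Qed.

(** By irreducibility the cyclic module of [u] is the whole space, so every [v] is a linear
    combination of the orbit of [u]. *)
Lemma dual_act_orbit_eigen i k a (u : dual_space i) :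
  u != 0 ->
  (forall h, dual_act i h u \in passmx.leigenspace (dual_act i k) a) ->
  passmx.leigenspace (dual_act i k) a = fullv.
Proof.
move=> u0 Eu; apply/eqP; rewrite eqEsubv subvf; apply/subvP => v _.
have [_ /(_ _ (cyclic_mx_module _ u))] := (mx_irrP _).1 (socle_irr i).
rewrite cyclic_mx_eq0 => /(_ u0) /(submx_full v)/cyclic_mxP[A].
case/envelop_mxP => c -> ->; rewrite mulmx_sumr.
apply: memv_suml => h _; rewrite -scalemxAr memvZ //.
by have := Eu h^-1%g; rewrite dual_actE invgK.
Qed.

(** * Criteria for a projective embedding *)

Section Embeddings.

Variables (V : {vspace group_alg C gT}) (U : forall i, {vspace dual_space i}).
Hypotheses (Vsub : subrepresentation V) (VU : multiplicity_spaces V U).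

Lemma acts_projectively_triviallyP k :
  acts_projectively_trivially U k <->
  exists2 a, a != 0 & (V <= right_eigenspace k a)%VS.
Proof.
split=> -[a a0 Ha]; exists a => //.
  apply: (subrep_subvP Vsub) => i; rewrite VU.
  apply/tensor_space_right_eigenspace.
  have [-> | Ui0] := eqVneq (U i) 0%VS; first exact: sub0v.
  by apply/subvP => u Uu; apply/leigenspaceP/Ha.
move=> i u _ Uu; apply/leigenspaceP; move: u Uu; apply/subvP.
by apply/tensor_space_right_eigenspace; rewrite -VU (subv_trans (capvSl _ _)).
Qed.

Lemma projective_embedding_triviallyP :
  V <> 0%VS ->
  projective_embedding V <->
  (forall k, acts_projectively_trivially U k <-> k = 1%g).
Proof.
move=> V0; apply: iff_trans (projective_embeddingP Vsub V0) _.
split=> [Vtriv k | Utriv k a a0 Vka].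
  split=> [/acts_projectively_triviallyP[a a0] | ->]; first exact: Vtriv.
  exists 1; rewrite ?oner_neq0 // => i u _ _.
  by rewrite dual_actE invg1 repr_mx1 mulmx1 scale1r.
by apply/Utriv/acts_projectively_triviallyP; exists a.
Qed.

(** Supplies the base character [psi_1] of the affine generators. *)
Lemma multiplicity_space_neq0 : V <> 0%VS -> exists i, U i != 0%VS.
Proof.
move=> V0; apply: contrapT => U0; case: V0; apply/eqP; rewrite -subv0.
apply: (subrep_subvP Vsub) => i; rewrite VU.
have /eqP -> : U i == 0%VS by apply: contra_notT U0; exists i.
apply/span_subvP => _ /allpairsP[[w u] /= [_ /vbasis_mem + ->]].
rewrite memv0 => /eqP ->; rewrite memv0; apply/eqP/ffunP => x.
by rewrite !ffunE mul0mx mxE.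
Qed.

Lemma embedding_jointly_faithful :
  V <> 0%VS -> projective_embedding V -> jointly_faithful U.
Proof.
move=> V0 /(projective_embedding_triviallyP V0) Utriv.
(* [dual_act] inverts its argument, so [g^-1] is the element shown to act trivially, with scalar
   1. *)
apply/trivgP/subsetP => g /bigcapP gK; rewrite inE -eq_invg1; apply/eqP/Utriv.
exists 1; rewrite ?oner_neq0 // => i u Ui _.
have /rkerP[_ gi] := gK i Ui.
by rewrite dual_actE invgK gi mulmx1 scale1r.
Qed.

(** On the centre, [multiplicative_on] unfolds to [center_character], so [irr_mode i] may itself be
    expressed through affine generators. *)
Lemma irr_mode_multiplicative i : multiplicative_on 'Z(G)%g (irr_mode i).
Proof.
have splitG := @group_closure_closed_field C gT G.
split; first exact: irr_mode_neq0.
exact: irr_modeM.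
Qed.

Lemma irr_center_scalarC i z :
  z \in 'Z(G)%g -> irr_repr i z = (irr_mode i z)%:M.
Proof. exact/irr_center_scalar/group_closure_closed_field. Qed.

Lemma embedding_affine_generators :
  V <> 0%VS -> projective_embedding V -> affine_generators U.
Proof.
move=> V0 /(projective_embedding_triviallyP V0) Utriv.
have [i1 Ui1] := multiplicity_space_neq0 V0; exists i1 => // xi xiP.
apply: (@separating_characters_generate _ _ 'Z(G)%G) xiP => [i _ | z Zz chi1].
  have [mode0 modeM] := irr_mode_multiplicative i.
  have [mode10 mode1M] := irr_mode_multiplicative i1.
  split=> [z Zz | y z Zy Zz].
    by rewrite mulf_neq0 ?invr_eq0 ?mode0 ?mode10.
  by rewrite modeM // mode1M // invfM mulrACA.
(* All quotients are 1 at [z], so [z^-1] acts on every [U i] by the common scalar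
   [irr_mode i1 z]. *)
apply/eqP; rewrite -eq_invg1; apply/eqP/Utriv.
have mode1_neq0 := (irr_mode_multiplicative i1).1 z Zz.
exists (irr_mode i1 z) => // i u Ui _.
rewrite dual_actE invgK irr_center_scalarC // mul_mx_scalar.
by rewrite (canRL (mulfVK mode1_neq0) (chi1 i Ui)) mul1r.
Qed.

(** Common core of the full and the projectively general cases; each of them supplies the last
    hypothesis in its own way. *)
Lemma embedding_of_scalars :
  V <> 0%VS -> jointly_faithful U -> affine_generators U ->
  (forall i k a, U i != 0%VS ->
    (U i <= passmx.leigenspace (dual_act i k) a)%VS ->
    passmx.leigenspace (dual_act i k) a = fullv) ->
  projective_embedding V.
Proof.
move=> V0 Ufaith [i1 Ui1 Ugen] Uscal.
apply/(projective_embeddingP Vsub V0) => k a a0 Vka.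
have scal i : U i != 0%VS -> irr_repr i k^-1%g = a%:M.
  move=> Ui; have Eik : passmx.leigenspace (dual_act i k) a = fullv.
    apply: Uscal => //; apply/tensor_space_right_eigenspace.
    by rewrite -VU (subv_trans (capvSl _ _)).
  apply/row_matrixP => j; rewrite !rowE.
  have /leigenspaceP : delta_mx 0 j \in passmx.leigenspace (dual_act i k) a.
    by rewrite Eik memvf.
  by rewrite dual_actE => ->; rewrite mul_mx_scalar.
have in_ker g : (forall i, U i != 0%VS -> irr_repr i g = 1%:M) -> g = 1%g.
  move=> g1; apply/set1P; rewrite -[[set _]]Ufaith; apply/bigcapP => i Ui.
  by apply/rkerP; rewrite inE g1.
(* A commutator with an element acting by scalars is trivial in every occurring representation. *)
have Zk : k^-1%g \in 'Z(G)%g.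
  rewrite inE inE; apply/centP => h _; apply/commgP/eqP/in_ker => i Ui.
  have unit_rho g : irr_repr i g \in unitmx by rewrite repr_mx_unit ?inE.
  move: (k^-1)%g scal => x scal.
  rewrite /commg /conjg !irr_reprM !repr_mxV ?inE // scal //.
  by rewrite -scalar_mxC mulKmx // mulVmx // -(scal i Ui).
have mode_k i : U i != 0%VS -> irr_mode i k^-1%g = a.
  by move=> Ui; rewrite /irr_mode scal // mxE eqxx.
(* Express [psi_1] itself through the quotients: at [k^-1] each quotient is [a / a = 1], whence
   [a = 1]. *)
have [n /(_ _ Zk)] := Ugen _ (irr_mode_multiplicative i1).
rewrite mode_k // big1 => [a1 | i Ui]; last first.
  by rewrite !mode_k // divff // exp1rz.
apply/eqP; rewrite -eq_invg1; apply/eqP/in_ker => i Ui.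
by rewrite scal // a1.
Qed.

Lemma full_eigenspace i k a :
  full sG V -> U i != 0%VS ->
  (U i <= passmx.leigenspace (dual_act i k) a)%VS ->
  passmx.leigenspace (dual_act i k) a = fullv.
Proof.
move=> Vfull; rewrite -vpick0 => u0 /tensor_space_right_eigenspace/subvP UE.
apply: dual_act_orbit_eigen u0 _ => h.
(* Moving [h] from the dual factor to a right translation reduces the claim to the stability of [V]
   and of its isotypic component. *)
apply/pure_tensor_right_eigenspace => w; apply: UE.
rewrite -rtrans_pure_tensor -VU memv_cap.
have : pure_tensor w (vpick (U i)) \in tensor_space (U i).
  exact/pure_tensor_mem/memv_pick.
by rewrite -VU memv_cap => /andP[? ?]; rewrite rtrans_full ?rtrans_isotypic.
Qed.

End Embeddings.

End Decomposition.

Theorem proposition2p3 (R : realType) (gT : finGroupType)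
    (sG : irrType R[i] [set: gT])
    (V : {vspace group_alg R[i] gT})
    (U : forall i : sG, {vspace dual_space i})
    (V_subrep : subrepresentation V)
    (V_decomp : multiplicity_spaces V U) :
  (yields_map V <-> V <> 0%VS) /\
  (V <> 0%VS ->
    (projective_embedding V -> jointly_faithful U /\ affine_generators U) /\
    (full sG V -> jointly_faithful U -> affine_generators U ->
      projective_embedding V) /\
    (~ full sG V -> jointly_faithful U -> affine_generators U ->
      projectively_general U -> projective_embedding V) /\
    (projective_embedding V <->
      (forall g : gT, acts_projectively_trivially U g <-> g = 1%g))).
Proof.
split; first exact: yields_mapP.
move=> V0; split; [|split; [|split]].
- move=> Vemb; split; first exact: embedding_jointly_faithful Vemb.
  exact: embedding_affine_generators Vemb.
- move=> Vfull Ufaith Ugen; apply: embedding_of_scalars => // i k a Ui.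
  exact: full_eigenspace.
- move=> _ Ufaith Ugen Upg; apply: embedding_of_scalars => // i k a Ui.
  (* A proper eigenspace cannot contain [U i], by projective generality. *)
  by apply: contraTeq; apply: Upg.
- exact: projective_embedding_triviallyP.
Qed.
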